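(* Let $A$ be an $m\times n$ matrix with nonnegative integer entries and let $b=(b_1,\dots,b_m)^T$ be a vector with nonnegative integer entries. Put $f=\left(1,\ b_1+1,\ (b_1+1)(b_2+1),\ \dots,\ \prod_{i=1}^{m-1}(b_i+1)\right)^T\in\mathbb{Z}^m$. If $M(A,b)\neq\emptyset$, then $V(A,b)\subseteq V(f^TA,f^Tb)$.
   Context: For an integer matrix $B$ with $p$ rows and $q$ columns and an integer vector $d\in\mathbb{Z}^p$, $M(B,d)=\{x\in\mathbb{Z}^q : Bx=d,\ x\ge 0\}$ (inequalities between vectors are coordinatewise), and $V(B,d)$ denotes the set of vertices (extreme points) of the convex hull of $M(B,d)$ in $\mathbb{R}^q$. In particular, $f^TA$ is regarded as a $1\times n$ matrix and $f^Tb$ as an integer, so $M(f^TA,f^Tb)=\{x\in\mathbb{Z}^n : f^TAx=f^Tb,\ x\ge 0\}$. The $j$-th coordinate of $f$ is $f_j=\prod_{i=1}^{j-1}(b_i+1)$ for $j=1,\dots,m$ (empty product equal to $1$). *)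

(* Defs.v *)
From HB Require Import structures.
From mathcomp Require Import all_boot all_order all_algebra.
From mathcomp Require Import interval_inference.
From mathcomp Require Import classical_sets reals convex.

Set Implicit Arguments.
Unset Strict Implicit.
Unset Printing Implicit Defensive.

Import Order.TTheory GRing.Theory Num.Theory.

Local Open Scope classical_set_scope.
Local Open Scope ring_scope.
Local Open Scope convex_scope.

Definition convex_hull (R : numDomainType) (E : lmodType R) (X : set E) :
    set E :=
  smallest (@convex_set R E) X.

Definition extreme_points (R : numDomainType) (E : lmodType R)
    (C : set (convex_lmodType E)) : set E :=
  [set x | C x /\
    forall (y z : convex_lmodType E) (t : {i01 R}),
      C y -> C z -> 0 < t%:num -> t%:num < 1 ->
      x = y <| t |> z -> y = x /\ z = x].

Definition int_points (p q : nat) (B : 'M[int]_(p, q)) (d : 'cV[int]_p) :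
    set 'cV[int]_q :=
  [set x | B *m x = d /\ forall j, 0 <= x j 0].

Definition vertices (R : realType) (p q : nat) (B : 'M[int]_(p, q))
    (d : 'cV[int]_p) : set 'cV[R]_q :=
  extreme_points (convex_hull [set map_mx intr x | x in int_points B d]).

Arguments vertices R {p q} B d.

(* Indices start at 0, so f_j is the product over the i strictly below j. *)
Definition radix_weights (m : nat) (b : 'cV[int]_m) : 'cV[int]_m :=
  \col_(j < m) \prod_(i < m | (i < j)%N) (b i 0 + 1).

(* Main.v *)
(** In radix (b_1+1, ..., b_m+1) the number f^T b has all its digits maximal.
    If y >= 0 and f^T y = f^T b, comparing digits gives carries k_i >= 0 with
    k_0 = k_m = 0 and y_i + k_(i-1) = b_i + k_i (b_i + 1).  For the weights
    g_i = m + 1 - i, which are positive and strictly decreasing, this yields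
    g^T y - g^T b = sum_i k_i (g_i (b_i + 1) - g_(i+1)) >= 0, with equality only
    if all the carries vanish, i.e., y = b.  Hence x |-> g^T A x attains its
    minimum over M(f^T A, f^T b) exactly on M(A, b): the convex hull of the
    latter is a face of the convex hull of the former, and extreme points of a
    face are extreme points of the whole set. *)
Require Import Defs.
From HB Require Import structures.
From mathcomp Require Import all_boot all_order all_algebra.
From mathcomp Require Import interval_inference.
From mathcomp Require Import classical_sets reals convex.
From mathcomp Require Import zify ring lra.

Set Implicit Arguments.
Unset Strict Implicit.
Unset Printing Implicit Defensive.

Import Order.TTheory GRing.Theory Num.Theory.

Local Open Scope classical_set_scope.
Local Open Scope ring_scope.
Local Open Scope convex_scope.

Lemma sub_convex_hull (R : numDomainType) (E : lmodType R) (X : set E) :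
  X `<=` convex_hull X.
Proof. exact: sub_gen_smallest. Qed.

Lemma convex_convex_hull (R : numDomainType) (E : lmodType R) (X : set E) :
  convex_set (convex_hull X).
Proof.
move=> x y t /set_mem hx /set_mem hy; apply/mem_set => C [Cconv XC].
by apply/set_mem/Cconv; apply/mem_set; [apply: hx | apply: hy].
Qed.

Lemma convex_hull_min (R : numDomainType) (E : lmodType R) (X C : set E) :
  convex_set C -> X `<=` C -> convex_hull X `<=` C.
Proof. exact: smallest_sub. Qed.

Lemma linear_conv (R : numDomainType) (E : lmodType R) (h : {scalar E})
    (t : {i01 R}) (y z : convex_lmodType E) :
  h (y <| t |> z) = t%:num * h y + (1 - t%:num) * h z.
Proof. by rewrite linearD !linearZ. Qed.

Section FaceOfHull.
Variables (R : realType) (E : lmodType R) (h : {scalar E}) (c : R).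
Variables (S T : set E).
Hypothesis ST : S `<=` T.
Hypothesis T_ge : forall x, T x -> c <= h x.
Hypothesis S_argmin : forall x, T x -> (S x <-> h x = c).

Lemma convex_hull_const x : convex_hull S x -> h x = c.
Proof.
move: x; apply: convex_hull_min => [y z t /set_mem hy /set_mem hz|x Sx].
  by apply/mem_set; rewrite /= linear_conv hy hz; ring.
exact/(S_argmin (ST Sx)).
Qed.

(** The disjunction is stable under proper convex combinations: one point with [c < h] lifts the
    whole combination above [c], and two points of the other kind stay in the hull of [S]. *)
Lemma convex_hull_face x :
  convex_hull T x -> c < h x \/ (h x = c /\ convex_hull S x).
Proof.
move: x; apply: convex_hull_min => [|x Tx]; last first.
  have := T_ge Tx; rewrite le_eqVlt => /orP[/eqP hx|]; last by left.
  by right; split=> //; apply: sub_convex_hull; apply/(S_argmin Tx).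
apply/convex_setW => y z /set_mem Dy /set_mem Dz t t0 t1; apply/mem_set.
rewrite /= linear_conv.
case: Dy => [hy|[hy Sy]]; case: Dz => [hz|[hz Sz]]; last first.
- right; split; first by rewrite hy hz; ring.
  by apply/set_mem/convex_convex_hull; exact/mem_set.
- by left; nra.
- by left; nra.
- by left; nra.
Qed.

Lemma extreme_points_face :
  extreme_points (convex_hull S) `<=` extreme_points (convex_hull T).
Proof.
move=> x [Sx x_ext]; split.
  apply: convex_hull_min Sx; first exact: convex_convex_hull.
  by move=> u /ST; exact: sub_convex_hull.
(* Since [h x = c] is a proper average of [h y] and [h z], both at least [c], neither can exceed
   [c]. *)
move=> y z t /convex_hull_face Dy /convex_hull_face Dz t0 t1 xE.
have hE := convex_hull_const Sx; rewrite xE linear_conv in hE.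
case: Dy => [hy|[hy Sy]]; case: Dz => [hz|[hz Sz]];
  last exact: x_ext xE.
all: by exfalso; nra.
Qed.

End FaceOfHull.

Lemma radix_weight0 m (b : 'I_m.+1 -> int) :
  \prod_(i < m.+1 | (i < (ord0 : 'I_m.+1))%N) (b i + 1) = 1.
Proof. by rewrite big_pred0. Qed.

Lemma radix_weightS m (b : 'I_m.+1 -> int) (j : 'I_m) :
  \prod_(i < m.+1 | (i < lift ord0 j)%N) (b i + 1) =
  (b ord0 + 1) * \prod_(i < m | (i < j)%N) (b (lift ord0 i) + 1).
Proof. by rewrite big_mkcond big_ord_recl /= -big_mkcond. Qed.

(** One step of Horner's scheme, used to peel off the lowest digit. *)
Lemma radix_sum_recl m (b y : 'I_m.+1 -> int) :
  \sum_(j < m.+1) (\prod_(i < m.+1 | (i < j)%N) (b i + 1)) * y j =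
  y ord0 + (b ord0 + 1) *
    \sum_(j < m) (\prod_(i < m | (i < j)%N) (b (lift ord0 i) + 1)) * y (lift ord0 j).
Proof.
rewrite big_ord_recl radix_weight0 mul1r mulr_sumr; congr (_ + _).
by apply: eq_bigr => j _; rewrite radix_weightS mulrA.
Qed.

(* [c] is the carry into the lowest digit; the induction removes that digit. *)
Lemma radix_carry m (b y : 'I_m -> int) (c : int) :
    (forall i, 0 <= b i) -> (forall i, 0 <= y i) -> 0 <= c ->
    c + \sum_(j < m) (\prod_(i < m | (i < j)%N) (b i + 1)) * y j =
      \sum_(j < m) (\prod_(i < m | (i < j)%N) (b i + 1)) * b j ->
  let g := fun z : 'I_m -> int => \sum_(j < m) (m - j)%:Z * z j in
  g b <= g y + m.+1%:Z * c /\ (g y + m.+1%:Z * c = g b -> c = 0 /\ y =1 b).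
Proof.
elim: m b y c => [|m IHm] b y c b0 y0 c0.
  by rewrite /= !big_ord0 => cE; split=> [|_]; [lia | split; [lia | case]].
rewrite !radix_sum_recl /=.
set Sy := \sum_j _ * y _; set Sb := \sum_j _ * b _ => sumE.
have bpos := b0 ord0; have ypos := y0 ord0.
have [k k0 yE] : exists2 k, 0 <= k & y ord0 + c = b ord0 + k * (b ord0 + 1).
  (* By [sumE], [y ord0 + c - b ord0] is [b ord0 + 1] times this witness; being at least [- b ord0],
     it excludes a negative factor. *)
  by exists (Sb - Sy); nia.
have kE : k + Sy = Sb by nia.
have [] := IHm (b \o lift ord0) (y \o lift ord0) k (fun=> b0 _) (fun=> y0 _)
  k0 kE.
rewrite !big_ord_recl /= subn0.
have shiftE (z : 'I_m.+1 -> int) :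
    \sum_(i < m) (m.+1 - bump 0 i)%:Z * z (lift ord0 i) =
    \sum_(j < m) (m - j)%:Z * z (lift ord0 j) by [].
rewrite !shiftE; set Gy := \sum_j _ * y _; set Gb := \sum_j _ * b _.
(* The outgoing carry [k] is charged [m.+1], the weight of the removed digit. The gap is thus that
   of [IHle] plus [m.+1 * k * b ord0 + c]. A zero gap gives [c = 0] and equality in [IHle], whence
   [k = 0] by [IHeq], even if [b ord0 = 0]. *)
move=> IHle IHeq; split=> [|gE]; first by nia.
have kc : k = 0 /\ c = 0 by split; nia.
case: kc => k_0 c_0; split=> // i.
have [|_ yb] := IHeq; first by nia.
case: (unliftP ord0 i) => [j|] ->; first exact: yb.
by nia.
Qed.

Lemma radix_argmin m (b y : 'cV[int]_m) :
    (forall i, 0 <= b i 0) -> (forall i, 0 <= y i 0) ->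
    (radix_weights b)^T *m y = (radix_weights b)^T *m b ->
  let g := \row_(j < m) (m - j)%:Z in
  (g *m b) 0 0 <= (g *m y) 0 0 /\ ((g *m y) 0 0 = (g *m b) 0 0 -> y = b).
Proof.
move=> b0 y0 fE g.
have gE (z : 'cV[int]_m) : (g *m z) 0 0 = \sum_(j < m) (m - j)%:Z * z j 0.
  by rewrite mxE; apply: eq_bigr => j _; rewrite mxE.
have fzE (z : 'cV[int]_m) : ((radix_weights b)^T *m z) 0 0 =
    \sum_(j < m) (\prod_(i < m | (i < j)%N) (b i 0 + 1)) * z j 0.
  by rewrite mxE; apply: eq_bigr => j _; rewrite !mxE.
have := @radix_carry m (b^~ 0) (y^~ 0) 0 b0 y0 (lexx _).
rewrite add0r -!fzE fE /= mulr0 addr0 -!gE => /(_ erefl)[gle geq].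
by split=> // /geq[_ yb]; apply/colP.
Qed.

Theorem theorem1 (R : realType) (m n : nat) (A : 'M[int]_(m, n))
    (b : 'cV[int]_m) (f : 'cV[int]_m)
    (A_ge0 : forall i j, 0 <= A i j)
    (b_ge0 : forall i, 0 <= b i 0)
    (f_def : f = radix_weights b)
    (M_neq0 : int_points A b !=set0) :
  vertices R A b `<=` vertices R (f^T *m A) (f^T *m b).
Proof.
(* As [j] starts at 0, these weights run from [m] down to 1. *)
rewrite {}f_def {M_neq0}; pose g := \row_(j < m) (m - j)%:Z.
pose h (v : 'cV[R]_n) : R := (map_mx intr (g *m A) *m v) 0 0.
have h_linear : scalar h by move=> a u v; rewrite /h mulmxDr -scalemxAr !mxE.
pose hL : {scalar 'cV[R]_n} :=
  HB.pack h (GRing.isLinear.Build R 'cV[R]_n R *%R h h_linear).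
have hE (x : 'cV[int]_n) : h (map_mx intr x) = ((g *m (A *m x)) 0 0)%:~R.
  by rewrite /h -map_mxM mxE mulmxA.
have argmin (x : 'cV[int]_n) :
    int_points ((radix_weights b)^T *m A) ((radix_weights b)^T *m b) x ->
    (g *m b) 0 0 <= (g *m (A *m x)) 0 0 /\
    ((g *m (A *m x)) 0 0 = (g *m b) 0 0 -> A *m x = b).
  case=> fAx x0; apply: radix_argmin => //; last by rewrite mulmxA.
  (* Nonnegativity of [A] makes [A *m x] an admissible digit vector. *)
  by move=> i; rewrite mxE sumr_ge0 // => j _; rewrite mulr_ge0.
apply: (@extreme_points_face R _ hL ((g *m b) 0 0)%:~R).
- move=> _ [x [Ax x0] <-]; exists x => //; split=> //.
  by rewrite -mulmxA Ax.
- by move=> _ [x /argmin[gle _] <-]; rewrite /hL /= hE ler_int.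
- move=> _ [x Mx <-]; rewrite /hL /= hE; split=> [[u [Au _] ux]|].
    (* [x] and [u] are known to agree only after the embedding into the reals, which is
       injective. *)
    suff -> : x = u by rewrite Au.
    apply/matrixP => i j; have /matrixP/(_ i j) := ux.
    by rewrite !mxE => /intr_inj.
  move=> /intr_inj gE; exists x => //; split; last by case: Mx.
  by have [_] := argmin _ Mx; apply.
Qed.
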